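(* Let $R$ be a polynomial ring over a field, $I$ a monomial ideal in $R$, and $a,b,c$ distinct variables in $R$ such that $\mathcal{G}(I)=\{ab,ac,M_1,\ldots,M_p\}$ with $a\nmid M_i$ for $1\le i\le p$. Moreover, suppose that $d_b(I)=d_c(I)=1$. Let $I_1=\operatorname{in}_{>}(I,a+b+c)$, where $>$ is a term order such that $a>b>c$. If $Q\in\operatorname{Min}(R/I_1)$, then there exists $P\in\operatorname{Min}(R/I)$ such that either $Q=(P,a)$ if $c\in P$, or $Q=(P,b)$ if $c\notin P$.
   Context: For a monomial ideal $I$, $\mathcal{G}(I)$ denotes its set of (minimal) monomial generators. For a variable $x$ and a monomial $M$, $d_x(M)$ is the degree of $x$ in $M$, and $d_x(I)=\max\{d_x(M)\mid M\in\mathcal{G}(I)\}$. $\operatorname{Min}(R/J)$ is the set of minimal associated primes of $R/J$. $\operatorname{in}_{>}(I,f)$ is the initial ideal with respect to $>$ of the ideal generated by $I$ and $f$; $(P,a)$ is the ideal generated by $P$ and $a$. *)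

(* Defs.v *)
From mathcomp Require Import all_boot all_order all_algebra.
From mathcomp Require Import boolp classical_sets.
From mathcomp Require Import mpoly.

Set Implicit Arguments.
Unset Strict Implicit.
Unset Printing Implicit Defensive.

Import GRing.Theory.

Local Open Scope classical_set_scope.
Local Open Scope ring_scope.

(* Ideals are classical sets: the structure [idealr] of MathComp only covers
   proper ideals, while an initial or a generated ideal may be the whole ring. *)
Section CommutativeAlgebra.
Variable A : comNzRingType.

Definition ideal_gen (S : set A) : set A :=
  [set f | exists s : seq (A * A),
     (forall x, x \in s -> S x.2) /\ f = \sum_(x <- s) x.1 * x.2].

(* [idealr_closed] includes [1 \notin P]. *)
Definition prime_ideal (P : set A) : Prop :=
  idealr_closed (fun f => f \in P) /\ prime_idealr_closed (fun f => f \in P).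

(* Ass(A/J): the prime ideals that are the annihilator of the class modulo J
   of some [f]. *)
Definition Ass (J : set A) : set (set A) :=
  [set P | prime_ideal P /\ exists f, P = [set r | J (r * f)]].

Definition MinAss (J : set A) : set (set A) :=
  [set P | Ass J P /\ forall P', Ass J P' -> P' `<=` P -> P' = P].

End CommutativeAlgebra.

Section MonomialIdeals.
Variables (n : nat) (K : fieldType).
Implicit Types (I J : set {mpoly K[n]}) (S : set 'X_{1..n}).
Implicit Types (G : seq 'X_{1..n}) (m : 'X_{1..n}).

Definition mon_ideal S : set {mpoly K[n]} :=
  ideal_gen [set 'X_[K, m] | m in S].

Definition is_monomial_ideal I : Prop := exists S, I = mon_ideal S.

(* G(I) = G, where the list [G] stands for its set of elements; G(I) is finite
   by Dickson's lemma. *)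
Definition is_mingens I G : Prop :=
  I = mon_ideal [set` G] /\
  forall G', {subset G' <= G} -> I = mon_ideal [set` G'] -> {subset G <= G'}.

(* d_x(I) = d, for the variable x of index [x]. *)
Definition is_degree_in (x : 'I_n) I (d : nat) : Prop :=
  exists2 G, is_mingens I G & d = (\max_(m <- G) m x)%N.

(* [le] is the non-strict order. *)
Definition term_order (le : rel 'X_{1..n}) : Prop :=
  [/\ total le, antisymmetric le, transitive le,
      forall m, le 0%MM m
    & forall m m1 m2, le m1 m2 -> le (m1 + m)%MM (m2 + m)%MM].

Definition term_gt (le : rel 'X_{1..n}) : rel 'X_{1..n} :=
  fun m1 m2 => (m1 != m2) && le m2 m1.

(* The zero polynomial, with empty support, has no leading monomial. *)
Definition is_lead_mon (le : rel 'X_{1..n}) (f : {mpoly K[n]}) m : Prop :=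
  m \in msupp f /\ forall m', m' \in msupp f -> le m' m.

Definition initial_ideal (le : rel 'X_{1..n}) J : set {mpoly K[n]} :=
  mon_ideal [set m | exists2 f, J f & is_lead_mon le f m].

End MonomialIdeals.

(* Main.v *)
Require Import Defs.
From mathcomp Require Import all_boot all_order all_algebra.
From mathcomp Require Import boolp classical_sets.
From mathcomp Require Import mpoly ring.

(** The minimal primes of a monomial ideal are generated by variables
    ([MinAss_mon_ideal]): they are the ideals (S), where S is a minimal set of
    variables that meets every monomial of the ideal. So the proposition
    compares the minimal covers of I with those of the initial ideal I_1 of
    J = (I, l), where l = a + b + c.

    Let S be a minimal cover of I_1. It contains a, the leading monomial of l,
    and b, since b^2 is the leading monomial of b l - a b.

    If c is in S, put P = (S \ a). The set S \ a contains b and c and still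
    meets every M_i, which a does not divide, so it covers I. It is minimal: a
    cover T of I inside S \ a contains b and c because it meets a b and a c
    without containing a; then all of J lies in (T, a), so T with a covers I_1
    and equals S.

    If c is not in S, the set S \ b covers I. Indeed modulo J one has a c = 0
    and hence b c = - c^2, so that M_i = b^e r yields c^(e+1) r in J
    ([ideal_replace]); as S avoids c, it meets r, which is prime to b. Take a
    minimal cover T of I inside S \ b. It contains a, having to meet a b. The
    set T with b covers I_1, hence equals S, and P = (T) is the required prime.

    Showing that a set covers I_1 requires control of the leading monomials of
    all the elements of J. No Groebner basis is needed: it is enough to
    substitute for each variable of the set a scalar multiple of a variable
    that is not larger, in such a way that J is sent to 0
    ([covers_initial_ideal]). In the first case every variable of the set is
    sent to 0; in the second one b is sent to - c and the others to 0. *)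

Set Implicit Arguments.
Unset Strict Implicit.
Unset Printing Implicit Defensive.

Import GRing.Theory.

Local Open Scope classical_set_scope.
Local Open Scope ring_scope.

(** * Ideals as classical sets *)

Section Ideals.
Context {A : comNzRingType}.
Implicit Types (S T P J : set A).

(** Unlike [idealr_closed], this allows the unit ideal. *)
Definition is_ideal T : Prop :=
  T 0 /\ forall r u v, T u -> T v -> T (r * u + v).

Lemma idealM T r u : is_ideal T -> T u -> T (r * u).
Proof. by case=> T0 TM Tu; rewrite -[_ * _]addr0; apply: TM. Qed.

Lemma idealD T u v : is_ideal T -> T u -> T v -> T (u + v).
Proof. by case=> _ TM Tu; rewrite -[u]mul1r; apply: TM. Qed.

Lemma idealB T u v : is_ideal T -> T u -> T v -> T (u - v).
Proof. by case=> _ TM Tu Tv; rewrite addrC -mulN1r; apply: TM. Qed.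

Lemma ideal_sum T (I : eqType) (s : seq I) (F : I -> A) :
  is_ideal T -> (forall i, i \in s -> T (F i)) -> T (\sum_(i <- s) F i).
Proof.
move=> iT TF; rewrite big_seq; elim/big_ind: _ => //; first by case: iT.
by move=> u v; apply: idealD.
Qed.

Lemma ideal_gen_ideal S : is_ideal (ideal_gen S).
Proof.
split=> [|r _ _ [s [Ss ->]] [t [St ->]]].
  by exists [::]; rewrite big_nil; split.
exists ([seq (r * x.1, x.2) | x <- s] ++ t); split=> [x|].
  by rewrite mem_cat => /orP[/mapP[y ys ->]|/St//]; apply: (Ss y).
rewrite big_cat big_map mulr_sumr; congr (_ + _).
by apply: eq_bigr => x _; rewrite mulrA.
Qed.

Lemma ideal_gen_sub S : S `<=` ideal_gen S.
Proof.
move=> x Sx; exists [:: (1, x)]; rewrite big_seq1 mul1r; split=> // y.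
by rewrite inE => /eqP ->.
Qed.

Lemma ideal_gen_min S T : is_ideal T -> S `<=` T -> ideal_gen S `<=` T.
Proof.
by move=> iT ST _ [s [Ss ->]]; apply: ideal_sum => // x /Ss/ST; apply: idealM.
Qed.

Lemma prime_ideal_ideal P : prime_ideal P -> is_ideal P.
Proof.
case=> -[P0 _ PM] _; split=> [|r u v Pu Pv]; first by rewrite inE in P0.
by have := PM r u v; rewrite !inE; apply.
Qed.

Lemma prime_ideal_mul P u v : prime_ideal P -> P (u * v) -> P u \/ P v.
Proof.
by case=> _ Pp Puv; have := Pp u v; rewrite !inE => /(_ Puv)/orP[];
  rewrite inE; [left|right].
Qed.

Lemma prime_ideal1 P : prime_ideal P -> ~ P 1.
Proof. by case=> -[_ + _] _ P1; rewrite mem_set. Qed.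

Lemma prime_ideal_prod P (I : Type) (s : seq I) (F : I -> A) :
  prime_ideal P -> P (\prod_(i <- s) F i) -> exists i, P (F i).
Proof.
move=> pP; apply: contraPP => noF; elim/big_ind: _ => //.
- exact: prime_ideal1.
- by move=> u v Pu Pv /(prime_ideal_mul pP)[].
- by move=> i _ Pi; apply: noF; exists i.
Qed.

Lemma prime_ideal_exp P u k : prime_ideal P -> P (u ^+ k) -> P u.
Proof.
move=> pP; elim: k => [|k IHk]; first by move/(prime_ideal1 pP).
by rewrite exprS => /(prime_ideal_mul pP)[].
Qed.

Lemma Ass_prime J P : Ass J P -> prime_ideal P.
Proof. by case. Qed.

Lemma Ass_sub J P : is_ideal J -> Ass J P -> J `<=` P.
Proof. by move=> iJ [_ [f ->]] r Jr /=; rewrite mulrC; apply: idealM. Qed.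

End Ideals.

(** * Ideals spanned by monomials *)

Section SupportIdeals.
Context {n : nat} {K : fieldType}.
Implicit Types (J : set {mpoly K[n]}) (U : set 'X_{1..n}) (S T : {set 'I_n}).
Implicit Types (m : 'X_{1..n}) (f g : {mpoly K[n]}).

Definition supp_ideal U : set {mpoly K[n]} :=
  [set f | forall m, m \in msupp f -> U m].

Definition up_closed U : Prop := forall m m', U m -> U (m + m')%MM.

Lemma supp_ideal_ideal U : up_closed U -> is_ideal (supp_ideal U).
Proof.
move=> Uup; split=> [m|r u v Uu Uv m]; first by rewrite msupp0.
move/msuppD_le; rewrite mem_cat => /orP[|/Uv//].
move/msuppM_le=> /allpairsP[[m1 m2] /= [_ m2u ->]].
by rewrite addmC; apply/Uup/Uu.
Qed.

Lemma supp_idealX U m : supp_ideal U 'X_[m] <-> U m.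
Proof.
split=> [|Um m']; first by apply; rewrite msuppX inE.
by rewrite msuppX inE => /eqP->.
Qed.

(** Ideals need not satisfy the converse; the monomial ones do
    ([mon_ideal_supp]). *)
Lemma ideal_supp J f :
  is_ideal J -> (forall m, m \in msupp f -> J 'X_[m]) -> J f.
Proof.
move=> iJ Jf; rewrite [f]mpolyE; apply: ideal_sum => // m mf.
by rewrite -mul_mpolyC; apply: idealM iJ (Jf m mf).
Qed.

(** This turns questions about a monomial ideal into divisibility of
    monomials. *)
Lemma mon_idealE U :
  mon_ideal (K:=K) U = supp_ideal [set m | exists2 u, U u & (u <= m)%MM].
Proof.
apply/seteqP; split.
  apply: ideal_gen_min.
    apply: supp_ideal_ideal => m m' [u Uu um]; exists u => //.
    exact: lepm_trans um (lem_addr _ _).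
  by move=> _ [u Uu <-]; apply/supp_idealX; exists u; rewrite ?lepm_refl.
move=> f Uf; apply: ideal_supp (ideal_gen_ideal _) _ => m /Uf[u Uu um].
rewrite -(submK um) mpolyXD; apply: idealM (ideal_gen_ideal _) _.
by apply: ideal_gen_sub; exists u.
Qed.

Lemma mon_idealX U m :
  mon_ideal U 'X_[K, m] <-> exists2 u, U u & (u <= m)%MM.
Proof. by rewrite mon_idealE; apply: supp_idealX. Qed.

Lemma mon_ideal_supp U f m :
  mon_ideal U f -> m \in msupp f -> mon_ideal U 'X_[K, m].
Proof. by rewrite mon_idealE => Uf /Uf Um; apply/supp_idealX. Qed.

(** * Ideals generated by variables *)

Definition meets S m : bool := [exists i in S, m i != 0%N].

Lemma meetsP S m : reflect (exists2 i, i \in S & m i != 0%N) (meets S m).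
Proof. exact: exists_inP. Qed.

Lemma meetsD S m1 m2 : meets S (m1 + m2)%MM = meets S m1 || meets S m2.
Proof.
apply/meetsP/orP=> [[i iS]|[]/meetsP[i iS mi]].
- rewrite mnmDE addn_eq0 negb_and => /orP[] mi; [left|right];
  by apply/meetsP; exists i.
- by exists i; rewrite // mnmDE addn_eq0 (negPf mi).
- by exists i; rewrite // mnmDE addn_eq0 (negPf mi) andbF.
Qed.

Lemma meets1 S i : meets S U_(i)%MM = (i \in S).
Proof.
apply/meetsP/idP=> [[j jS]|iS]; last by exists i => //; rewrite mnm1E eqxx.
by rewrite mnm1E; case: (eqVneq i j) => [->|].
Qed.

Lemma meets0 S : meets S 0%MM = false.
Proof. by apply/meetsP => -[i _]; rewrite mnm0E. Qed.

Lemma sub_meets {S T m} : S \subset T -> meets S m -> meets T m.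
Proof. by move=> /fintype.subsetP ST /meetsP[i /ST iT mi]; apply/meetsP; exists i. Qed.

Lemma lem_meets S m1 m2 : (m1 <= m2)%MM -> meets S m1 -> meets S m2.
Proof. by move=> /submK<- m1S; rewrite meetsD m1S orbT. Qed.

Lemma meetsMn S m k : meets S (m *+ k)%MM -> meets S m.
Proof.
case/meetsP=> i iS; rewrite mulmnE muln_eq0 negb_or => /andP[mi _].
by apply/meetsP; exists i.
Qed.

Definition var_ideal S : set {mpoly K[n]} := supp_ideal (meets S).

Lemma var_ideal_ideal S : is_ideal (var_ideal S).
Proof. by apply: supp_ideal_ideal => m m'; rewrite /= meetsD => ->. Qed.

Lemma var_idealX S m : var_ideal S 'X_[m] <-> meets S m.
Proof. exact: supp_idealX. Qed.

Lemma var_idealXi S i : var_ideal S 'X_i <-> i \in S.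
Proof. by rewrite -meets1; apply: var_idealX. Qed.

Lemma var_ideal_min S J :
  is_ideal J -> (forall i, i \in S -> J 'X_i) -> var_ideal S `<=` J.
Proof.
move=> iJ JS f Sf; apply: ideal_supp => // m /Sf/meetsP[i iS mi].
have le_im: (U_(i) <= m)%MM.
  by apply/mnm_lepP=> j; rewrite mnm1E; case: (eqVneq i j) => [<-|];
    rewrite ?lt0n.
by rewrite -(submK le_im) mpolyXD; apply: idealM iJ (JS i iS).
Qed.

Lemma var_idealU1 S i :
  ideal_gen (var_ideal S `|` [set 'X_i]) = var_ideal (i |: S).
Proof.
apply/seteqP; split.
  apply: ideal_gen_min => [|f [Sf m /Sf|->]]; first exact: var_ideal_ideal.
    exact/sub_meets/finset.subsetUr.
  by apply/var_idealXi; rewrite finset.setU11.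
apply: var_ideal_min => [|j]; first exact: ideal_gen_ideal.
by rewrite !inE => /orP[/eqP->|jS]; apply: ideal_gen_sub;
  [right|left; apply/var_idealXi].
Qed.

(** * Substituting a multiple of a variable for each variable *)

Definition subst (e : 'I_n -> K) (s : 'I_n -> 'I_n) f : {mpoly K[n]} :=
  f \mPo [tuple e i *: 'X_(s i) | i < n].

Lemma substX e s m :
  subst e s 'X_[m] =
  (\prod_i e i ^+ m i) *: 'X_[(\sum_i U_(s i) *+ m i)%MM].
Proof.
rewrite /subst comp_mpolyX -mprodXE -scaler_prod; apply: eq_bigr => i _.
by rewrite tnth_mktuple exprZn mpolyXn.
Qed.

Lemma substXi e s i : subst e s 'X_i = e i *: 'X_(s i).
Proof. by rewrite /subst comp_mpolyXU -tnth_nth tnth_mktuple. Qed.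

Lemma substM e s f g : subst e s (f * g) = subst e s f * subst e s g.
Proof. exact: rmorphM. Qed.

Lemma substD e s f g : subst e s (f + g) = subst e s f + subst e s g.
Proof. exact: raddfD. Qed.

Lemma subst_ker_ideal e s : is_ideal [set f | subst e s f = 0].
Proof.
split=> [|r u v /= u0 v0]; first exact: raddf0.
by rewrite substD substM u0 v0 mulr0 addr0.
Qed.

Lemma subst_ideal_gen e s (G : set {mpoly K[n]}) f :
  (forall g, G g -> subst e s g = 0) -> ideal_gen G f -> subst e s f = 0.
Proof. by move=> G0; apply: (ideal_gen_min (subst_ker_ideal e s) G0). Qed.

Lemma mcoeff_subst e s f m :
  (subst e s f)@_m = \sum_(m' <- msupp f) f@_m' *
    ((\prod_i e i ^+ m' i) * ((\sum_i U_(s i) *+ m' i)%MM == m)%:R).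
Proof.
rewrite {1}[f]mpolyE /subst [_ \mPo _]raddf_sum /= raddf_sum /=.
apply: eq_bigr => m' _.
by rewrite comp_mpolyZ mcoeffZ -/(subst e s _) substX mcoeffZ mcoeffX.
Qed.

(** The projection onto the polynomial ring in the variables outside S; its
    kernel is (S), which is therefore prime. *)
Definition kill S : {mpoly K[n]} -> {mpoly K[n]} :=
  subst (fun i => (i \notin S)%:R) id.

Lemma mcoeff_kill S f m : (kill S f)@_m = (~~ meets S m)%:R * f@_m.
Proof.
rewrite mcoeff_subst [in RHS](mpolyE f) linear_sum mulr_sumr /=.
apply: eq_bigr => m' _; rewrite mcoeffZ mcoeffX -multinomUE_id.
case: eqP => [<-|_]; rewrite !(mulr0, mulr1) // mulrC; congr (_ * _).
case: meetsP => [[i iS mi]|noi].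
  by rewrite (bigD1 i) //= iS expr0n (negPf mi) mul0r.
apply: big1 => i _; case: (boolP (i \in S)) => iS; rewrite ?expr1n //.
by case: (eqVneq (m' i) 0%N) => [->//|mi]; case: noi; exists i.
Qed.

Lemma kill_eq0 S f : kill S f = 0 <-> var_ideal S f.
Proof.
split=> [f0 m|Sf]; last apply/mpolyP=> m.
  rewrite mcoeff_msupp; apply: contraNT => mS.
  by have := mcoeff_kill S f m; rewrite f0 mS mcoeff0 mul1r => <-.
rewrite mcoeff_kill mcoeff0; case: (boolP (m \in msupp f)) => [/Sf->|].
  by rewrite mul0r.
by rewrite -mcoeff_eq0 => /eqP->; rewrite mulr0.
Qed.

Lemma var_ideal_prime S : prime_ideal (var_ideal S).
Proof.
have [S0 SM] := var_ideal_ideal S; split; first split.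
- exact: mem_set.
- apply/negP; rewrite inE -mpolyX0 => /var_idealX.
  by rewrite meets0.
- by move=> r u v; rewrite !inE; apply: SM.
move=> u v; rewrite inE => /kill_eq0; rewrite /kill substM => /eqP.
by rewrite mulf_eq0 => /orP[]/eqP/kill_eq0 ?; apply/orP; [left|right];
  rewrite inE.
Qed.

(** * Minimal primes of a monomial ideal *)

Definition covers J S : Prop := forall m, J 'X_[m] -> meets S m.

Definition min_cover J S : Prop :=
  covers J S /\ forall T, covers J T -> T \subset S -> T = S.

Lemma exists_min_cover J S :
  covers J S -> exists2 T, min_cover J T & T \subset S.
Proof.
move=> JS; have [|T] := @minset_exists _ (fun T => `[< covers J T >]) S.
  exact/asboolP.
case/minsetP=> /asboolP JT Tmin TS; exists T => //; split=> // T' /asboolP.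
exact: Tmin.
Qed.

Lemma covers_mon_ideal U S :
  (forall m, U m -> meets S m) -> covers (mon_ideal (K:=K) U) S.
Proof. by move=> US m /mon_idealX[u /US uS um]; apply: lem_meets uS. Qed.

(** A prime containing a monomial contains one of its variables. *)
Lemma prime_cover J P :
  prime_ideal P -> J `<=` P -> covers J [set i | `[< P 'X_i >]].
Proof.
move=> pP JP m /JP; rewrite mpolyXE_id => /(prime_ideal_prod pP)[i Pi].
apply/meetsP; exists i.
  by rewrite inE; apply/asboolP/(prime_ideal_exp pP Pi).
by apply/eqP=> mi0; apply: (prime_ideal1 pP); rewrite mi0 in Pi.
Qed.

(** Among the monomials u no multiple of which by a monomial avoiding S lies in
    J, take one of maximal degree in the variables of S. The maximum exists
    because, for i in S, minimality of S gives a monomial of J whose only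
    variable in S is i, and its i-exponent bounds that of u. By maximality each
    variable i of S has a monomial [v i] avoiding S with i u (v i) in J. If v0
    is the product of these, (S) is the annihilator of u v0 modulo J. *)
Lemma min_cover_Ass U S :
  let J := mon_ideal (K:=K) U in min_cover J S -> Ass J (var_ideal S).
Proof.
move=> J [JS Smin]; split; first exact: var_ideal_prime.
have iJ : is_ideal J by exact: ideal_gen_ideal.
pose A u := forall v, J 'X_[(u + v)%MM] -> meets S v.
have [k ubA] : exists k : 'I_n -> nat,
    forall i, i \in S -> forall u, A u -> (u i <= k i)%N.
  apply: (fin_all_exists (P := fun i k => i \in S -> forall u, A u -> (u i <= k)%N)) => i.
  case: (boolP (i \in S)) => iS; last by exists 0%N.
  (* [m i] will be the bound, where [m] is a monomial of [J] that avoids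
     [S :\ i]. *)
  have [m [Jm mSi]] : exists m, J 'X_[m] /\ ~~ meets (S :\ i) m.
    apply: contrapT => no_m; have /Smin : covers J (S :\ i).
      by move=> m Jm; apply: contraT => mSi; case: no_m; exists m.
    by move=> /(_ (finset.subsetDl _ _)) Si; rewrite -Si !inE eqxx in iS.
  exists (m i) => _ u Au; rewrite leqNgt; apply: contra mSi => lt_mu.
  (* Were [u i > m i], [m] would divide [u + v], so [v] would meet [S]. *)
  pose v := (m - U_(i) *+ m i)%MM.
  have le_m : (m <= u + v)%MM.
    apply/mnm_lepP=> j; rewrite mnmDE mnmBE mulmnE mnm1E.
    case: (eqVneq i j) => [<-|_]; first exact: leq_trans (ltnW lt_mu) (leq_addr _ _).
    by rewrite mul0n subn0 leq_addl.
  have /meetsP[j jS vj] : meets S v.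
    by apply: Au; rewrite -(submK le_m) mpolyXD; apply: idealM.
  apply/meetsP; exists j; rewrite ?inE; move: vj;
    rewrite mnmBE mulmnE mnm1E; case: (eqVneq i j) => [<-|ij].
  - by rewrite mul1n subnn.
  - by rewrite jS.
  - by rewrite mul1n subnn.
  - by rewrite mul0n subn0.
pose w u := (\sum_(i in S) u i)%N.
have exA : exists d, `[< exists2 u, A u & w u = d >].
  by exists (w 0%MM); apply/asboolP; exists 0%MM => // v; rewrite add0m; apply: JS.
have ubw d : `[< exists2 u, A u & w u = d >] -> (d <= \sum_(i in S) k i)%N.
  by case/asboolP=> u Au <-; apply: leq_sum => i iS; apply: ubA.
have [_ /asboolP[u Au <-] u_max] := ex_maxnP exA ubw.
have [v Jv] : exists v : 'I_n -> 'X_{1..n}, forall i, i \in S ->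
    J 'X_[(u + U_(i) + v i)%MM] /\ ~~ meets S (v i).
  apply: (fin_all_exists (P := fun i v => i \in S ->
    J 'X_[(u + U_(i) + v)%MM] /\ ~~ meets S v)) => i.
  apply: contrapT => no_v.
  have iS : i \in S by apply: contraT => /negP iS; case: no_v; exists 0%MM.
  have /u_max : `[< exists2 u', A u' & w u' = w (u + U_(i))%MM >].
    apply/asboolP; exists (u + U_(i))%MM => // v Jv; apply: contraT => vS.
    by case: no_v; exists v.
  rewrite /w (eq_bigr (fun j => u j + (i == j))%N); last first.
    by move=> j _; rewrite mnmDE mnm1E.
  rewrite big_split /= [X in (_ + X)%N](bigD1 i) //= eqxx addnA addn1.
  by rewrite addSn ltnNge leq_addr.
pose v0 := (\sum_(i in S) v i)%MM; exists 'X_[(u + v0)%MM].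
have v0S : ~~ meets S v0.
  rewrite /v0; elim/big_ind: _ => [|m1 m2|i /Jv[]//]; first by rewrite meets0.
  by rewrite meetsD negb_or => -> ->.
apply/seteqP; split=> [|f /= Jf m mf].
  apply: var_ideal_min => [|i iS] /=.
    split=> [|r f g /= Jf Jg]; first by rewrite /= mul0r; case: iJ.
    by rewrite mulrDl -mulrA; case: iJ => _; apply.
  rewrite -mpolyXD /v0 (bigD1 i) //= !addmA [(_ + u)%MM]addmC mpolyXD mulrC.
  exact: idealM iJ (Jv i iS).1.
have: meets S (m + v0)%MM.
  apply: Au; rewrite addmA [(u + m)%MM]addmC -addmA addmC; apply: mon_ideal_supp Jf _.
  by rewrite (perm_mem (msuppMX _ _)) map_f.
by rewrite meetsD (negPf v0S) orbF.
Qed.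

(** Every prime over J contains the variables of some minimal cover, and the
    ideal of that cover is itself an associated prime. *)
Lemma MinAss_mon_ideal U Q :
  let J := mon_ideal (K:=K) U in
  MinAss J Q <-> exists2 S, min_cover J S & Q = var_ideal S.
Proof.
move=> J; have iJ : is_ideal J by exact: ideal_gen_ideal.
split=> [[AQ Qmin]|[S JS ->]].
  have pQ := Ass_prime AQ.
  have [S JS SQ] := exists_min_cover (prime_cover pQ (Ass_sub iJ AQ)).
  exists S => //; apply/esym/Qmin; first exact: min_cover_Ass.
  apply: var_ideal_min => [|i /(fintype.subsetP SQ)]; first exact: prime_ideal_ideal.
  by rewrite inE => /asboolP.
split=> [|P AP PS]; first exact: min_cover_Ass.
have pP := Ass_prime AP; have JP := prime_cover pP (Ass_sub iJ AP).
apply/seteqP; split=> //; apply: var_ideal_min => [|i].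
  exact: prime_ideal_ideal.
rewrite -(JS.2 _ JP); first by rewrite inE => /asboolP.
by apply/fintype.subsetP=> j; rewrite inE => /asboolP/PS/var_idealXi.
Qed.

(** * Leading monomials *)

Lemma term_order_leD le m1 m2 p1 p2 :
  term_order le -> le m1 m2 -> le p1 p2 -> le (m1 + p1)%MM (m2 + p2)%MM.
Proof.
case=> _ _ trans_le _ leD le_m le_p; apply: trans_le (leD _ _ _ le_m) _.
by rewrite ![(m2 + _)%MM]addmC; apply: leD.
Qed.

(** Suppose that m is the leading monomial of f and avoids S. The substitution
    fixes m and never increases a monomial, so no other monomial of f, being
    smaller than m, contributes to the coefficient of m in the image of f.
    That coefficient is then the leading coefficient of f, and f is not sent
    to 0. *)
Lemma lead_mon_meets le e s S f m :
  term_order le -> (forall i, le U_(s i)%MM U_(i)%MM) ->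
  (forall i, i \notin S -> s i = i /\ e i = 1) ->
  subst e s f = 0 -> is_lead_mon le f m -> meets S m.
Proof.
move=> ord_le le_s fixS f0 [mf m_max]; apply: contraT => mS.
have [le_total le_anti _ le0 _] := ord_le.
have m0 i : i \in S -> m i = 0%N.
  by move=> iS; apply: contraNeq mS => mi; apply/meetsP; exists i.
have le_sm m' : le (\sum_i U_(s i) *+ m' i)%MM m'.
  rewrite [X in le _ X]multinomUE_id; elim/big_ind2: _ => // [*|i _].
    exact: term_order_leD.
  elim: (m' i) => [|k IHk]; first by rewrite !mulm0n.
  by rewrite !mulmS; apply: term_order_leD.
have sm : (\sum_i U_(s i) *+ m i)%MM = m.
  rewrite [RHS]multinomUE_id; apply: eq_bigr => i _.
  by have [/m0->|/fixS[-> _]//] := boolP (i \in S); rewrite !mulm0n.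
have em : \prod_i e i ^+ m i = 1.
  apply: big1 => i _.
  by have [/m0->|/fixS[_ ->]] := boolP (i \in S); rewrite ?expr0 ?expr1n.
have := mcoeff_subst e s f m; rewrite f0 mcoeff0.
rewrite (bigD1_seq m) ?msupp_uniq //= sm em eqxx !mulr1.
rewrite big1_seq => [|m' /andP[m'm m'f]].
  by rewrite addr0 => /esym/eqP; rewrite mcoeff_eq0 mf.
case: eqP => [s_m'|_]; last by rewrite !mulr0.
case/eqP: m'm; apply: le_anti.
by rewrite m_max //=; have := le_sm m'; rewrite s_m'.
Qed.

(** An upper bound for an initial ideal that uses only generators of the
    ideal. *)
Lemma covers_initial_ideal le e s S (G : set {mpoly K[n]}) :
  term_order le -> (forall i, le U_(s i)%MM U_(i)%MM) ->
  (forall i, i \notin S -> s i = i /\ e i = 1) ->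
  (forall g, G g -> subst e s g = 0) ->
  covers (initial_ideal le (ideal_gen G)) S.
Proof.
move=> ord_le le_s fixS G0; apply: covers_mon_ideal => m [f Jf].
exact: lead_mon_meets (subst_ideal_gen G0 Jf).
Qed.

Lemma lead_monD le m f :
  (forall m', m' \in msupp f -> term_gt le m m') -> reflexive le ->
  is_lead_mon le ('X_[m] + f) m.
Proof.
move=> lt_m refl_le; split=> [|m' /msuppD_le].
  rewrite mcoeff_msupp mcoeffD mcoeffX eqxx.
  have /eqP-> : f@_m == 0.
    by rewrite mcoeff_eq0; apply/negP=> /lt_m/andP[/eqP].
  by rewrite addr0 oner_eq0.
rewrite mem_cat msuppX inE => /orP[/eqP-> //|/lt_m/andP[]//].
Qed.

(** Modulo J the product (b + c) c = c (a + b + c) - a c vanishes, so b acts as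
    - c on the multiples of c: c times a monomial stays in J, up to a sign,
    when its powers of b are replaced by powers of c. *)
Lemma ideal_replace J (a b c : 'I_n) m :
  is_ideal J -> J ('X_a + 'X_b + 'X_c) -> J ('X_a * 'X_c) -> J 'X_[m] ->
  J 'X_[(U_(c) *+ (m b).+1 + (m - U_(b) *+ m b))%MM].
Proof.
move=> iJ Jl Jac Jm; set r := (m - _)%MM.
have mE : 'X_[m] = 'X_b ^+ m b * 'X_[r] :> {mpoly K[n]}.
  rewrite mpolyXn -mpolyXD addmC submK //; apply/mnm_lepP=> j.
  by rewrite mulmnE mnm1E; case: (eqVneq b j) => [<-|]; rewrite ?mul1n ?mul0n.
have Jbc : J (('X_b + 'X_c) * 'X_c).
  have -> : ('X_b + 'X_c) * 'X_c =
     'X_c * ('X_a + 'X_b + 'X_c) - 'X_a * 'X_c :> {mpoly K[n]}.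
    by ring.
  by apply: idealB => //; apply: idealM.
have Jk : J ('X_c * 'X_[r] * (- 'X_c) ^+ m b).
  have -> : 'X_c * 'X_[r] * (- 'X_c) ^+ m b =
     'X_c * 'X_[m] - 'X_c * 'X_[r] * ('X_b ^+ m b - (- 'X_c) ^+ m b) :> {mpoly K[n]}.
    by rewrite mulrBr mE [_ ^+ m b * 'X_[r]]mulrC mulrA subKr.
  apply: idealB => //; first exact: idealM.
  (* The difference of powers is divisible by [b - (- c)]. *)
  rewrite subrXX opprK; set t := (\sum_(i < _) _).
  have -> : 'X_c * 'X_[r] * (('X_b + 'X_c) * t) =
      ('X_[r] * t) * (('X_b + 'X_c) * 'X_c) by ring.
  exact: idealM.
have -> : 'X_[(U_(c) *+ (m b).+1 + r)%MM] =
    (-1) ^+ m b * ('X_c * 'X_[r] * (- 'X_c) ^+ m b) :> {mpoly K[n]}.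
  rewrite mulmS !mpolyXD -mpolyXn [(- 'X_c) ^+ _]exprNn.
  have ss : (-1) ^+ m b * (-1) ^+ m b = 1 :> {mpoly K[n]}.
    by rewrite -exprMn mulrNN mulr1 expr1n.
  by rewrite -[LHS]mul1r -{1}ss; ring.
exact: idealM.
Qed.

End SupportIdeals.

Theorem proposition2p6 (K : fieldType) (n : nat)
    (I : set {mpoly K[n]}) (a b c : 'I_n) (p : nat) (M : 'I_p -> 'X_{1..n})
    (le : rel 'X_{1..n}) :
  is_monomial_ideal I ->
  a != b -> a != c -> b != c ->
  is_mingens I [:: (U_(a) + U_(b))%MM, (U_(a) + U_(c))%MM & codom M] ->
  (forall i : 'I_p, ~~ (U_(a) <= M i)%MM) ->
  is_degree_in b I 1 ->
  is_degree_in c I 1 ->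
  term_order le ->
  term_gt le U_(a)%MM U_(b)%MM ->
  term_gt le U_(b)%MM U_(c)%MM ->
  let I1 := initial_ideal le (ideal_gen (I `|` [set 'X_a + 'X_b + 'X_c])) in
  forall Q : set {mpoly K[n]}, MinAss I1 Q ->
  exists P : set {mpoly K[n]}, MinAss I P /\
    ((P 'X_c /\ Q = ideal_gen (P `|` [set 'X_a])) \/
     (~ P 'X_c /\ Q = ideal_gen (P `|` [set 'X_b]))).
Proof.
move=> _ ab ac bc [IE _] aM _ _ ord_le gt_ab gt_bc; set J := ideal_gen _ => I1 Q.
have [le_total _ le_trans _ _] := ord_le.
have le_refl : reflexive le by move=> m; have := le_total m m; rewrite orbb.
have [/andP[_ le_ba] /andP[_ le_cb]] := (gt_ab, gt_bc).
pose l : {mpoly K[n]} := 'X_a + 'X_b + 'X_c.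
have iJ : is_ideal J by exact: ideal_gen_ideal.
have IJ m : I 'X_[m] -> J 'X_[m] by move=> Im; apply: ideal_gen_sub; left.
have Jl : J l by apply: ideal_gen_sub; right.
have Igen m : m \in [:: (U_(a) + U_(b))%MM, (U_(a) + U_(c))%MM & codom M] ->
    I 'X_[m].
  by move=> mG; rewrite IE; apply/mon_idealX; exists m => //; apply: lepm_refl.
have Iab : I ('X_a * 'X_b) by rewrite -mpolyXD; apply: Igen; rewrite inE eqxx.
have Iac : I ('X_a * 'X_c).
  by rewrite -mpolyXD; apply: Igen; rewrite !inE eqxx orbT.
have Jac : J ('X_a * 'X_c) by apply: ideal_gen_sub; left.
have IM i : I 'X_[(M i)] by apply: Igen; rewrite !inE codom_f !orbT.
have covI T : meets T (U_(a) + U_(b))%MM -> meets T (U_(a) + U_(c))%MM ->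
    (forall i, meets T (M i)) -> covers I T.
  move=> Tab Tac TM; rewrite IE; apply: covers_mon_ideal => m /=.
  by rewrite !inE => /or3P[/eqP->|/eqP->|/codomP[i ->]].
have covI1 (T : {set 'I_n}) e s : (forall i, le U_(s i)%MM U_(i)%MM) ->
    (forall i, i \notin T -> s i = i /\ e i = 1) ->
    subst e s ('X_a * 'X_b) = 0 -> subst e s ('X_a * 'X_c) = 0 ->
    (forall i, subst e s 'X_[(M i)] = 0) -> subst e s l = 0 -> covers I1 T.
  move=> le_s fixT kab kac kM kl.
  apply: (covers_initial_ideal ord_le le_s fixT) => g [|->//].
  move: g; rewrite IE => g; apply: subst_ideal_gen => _ [m /= + <-].
  by rewrite !inE => /or3P[/eqP->|/eqP->|/codomP[i ->]]; rewrite ?mpolyXD.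
have minI T : min_cover I T -> MinAss I (var_ideal T).
  by rewrite IE => IT; apply/MinAss_mon_ideal; exists T.
case/MinAss_mon_ideal=> S [I1S Smin] ->.
have leadS f m : J f -> is_lead_mon le f m -> meets S m.
  move=> Jf fm; apply/I1S/mon_idealX; exists m; last exact: lepm_refl.
  by exists f.
have monS m : J 'X_[m] -> meets S m.
  move=> /leadS; apply; split=> [|m']; rewrite msuppX inE //.
  by move/eqP->.
have aS : a \in S.
  rewrite -meets1; apply: leadS Jl _; rewrite /l -addrA; apply: lead_monD => // m.
  move/msuppD_le; rewrite mem_cat !msuppX !inE => /orP[]/eqP-> //.
  rewrite /term_gt (le_trans _ _ _ le_cb le_ba) andbT.
  by apply: contraNneq ac => /mnmP/(_ c); rewrite !mnm1E eqxx; case: eqVneq.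
have bS : b \in S.
  have Jbb : J ('X_[U_(b) + U_(b)] + 'X_[U_(b) + U_(c)]).
    have -> : 'X_[U_(b) + U_(b)] + 'X_[U_(b) + U_(c)] = 'X_b * l - 'X_a * 'X_b.
      by rewrite !mpolyXD /l; ring.
    apply: idealB => //; first exact: idealM.
    by apply: ideal_gen_sub; left.
  have : meets S (U_(b) + U_(b))%MM.
    apply: leadS Jbb _; apply: lead_monD => // m; rewrite msuppX inE => /eqP->.
    rewrite /term_gt (term_order_leD ord_le (le_refl _) le_cb) andbT.
    apply: contraNneq bc => /mnmP/(_ c); rewrite !mnmDE !mnm1E eqxx.
    by case: eqVneq.
  by rewrite meetsD meets1 orbb.
have [cS|cS] := boolP (c \in S).
(* The prime is obtained by removing [a] from [S]. *)
- have Sa : a |: (S :\ a) = S by rewrite finset.setD1K.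
  exists (var_ideal (S :\ a)); split; last first.
    left; rewrite var_idealU1 Sa; split=> //.
    by apply/var_idealXi; rewrite !inE cS eq_sym ac.
  apply: minI; split.
    apply: covI => [||i]; rewrite ?meetsD ?meets1 ?inE ?eqxx ?bS ?cS.
    + by rewrite eq_sym ab orbT.
    + by rewrite eq_sym ac orbT.
    have /meetsP[j jS Mj] := monS _ (IJ _ (IM i)).
    apply/meetsP; exists j; rewrite // !inE jS andbT.
    by apply: contraNneq (aM i) => <-; rewrite lep1mP.
  move=> T IT TS.
  have aT : a \notin T by apply/negP=> /(fintype.subsetP TS); rewrite !inE eqxx.
  have [bT cT] : b \in T /\ c \in T.
    have := IT _ (Igen _ (mem_head _ _)).
    have Gac : (U_(a) + U_(c))%MM \in
        [:: (U_(a) + U_(b))%MM, (U_(a) + U_(c))%MM & codom M].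
      by rewrite !inE eqxx orbT.
    have := IT _ (Igen _ Gac).
    by rewrite !meetsD !meets1 (negPf aT).
  have <- : a |: T = S.
    apply: Smin; last first.
      by rewrite -Sa; apply: finset.setUS.
    pose e i : K := (i \notin a |: T)%:R.
    have kill_mon m : meets (a |: T) m -> subst e id 'X_[m] = 0.
      by move=> Tm; apply/kill_eq0/var_idealX.
    apply: (covI1 _ e id) => [i|i iT|||i|] //.
    + by rewrite /e iT.
    + by rewrite -mpolyXD; apply: kill_mon; rewrite meetsD meets1 !inE eqxx.
    + by rewrite -mpolyXD; apply: kill_mon; rewrite meetsD meets1 !inE eqxx.
    + by apply/kill_mon/(sub_meets _ (IT _ (IM i)))/finset.subsetUr.
    + by rewrite /l !substD !kill_mon ?meets1 ?inE ?eqxx ?bT ?cT ?orbT ?addr0.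
  by rewrite finset.setU1K.
(* From here on [c] is not in [S]. Removing [b] leaves a cover of [I], maybe
   not a minimal one. *)
have [T IT TS] : exists2 T, min_cover I T & T \subset S :\ b.
  apply: exists_min_cover; apply: covI => [||i].
  - by rewrite meetsD meets1 !inE ab aS.
  - by rewrite meetsD meets1 !inE ab aS.
  have := monS _ (ideal_replace iJ Jl Jac (IJ _ (IM i))).
  rewrite meetsD => /orP[/meetsMn|]; first by rewrite meets1 (negPf cS).
  case/meetsP=> j jS; rewrite mnmBE mulmnE mnm1E.
  case: (eqVneq b j) => [<-|bj]; first by rewrite mul1n subnn.
  rewrite mul0n subn0 => Mj.
  by apply/meetsP; exists j; rewrite // !inE jS eq_sym bj.
have subT i : i \in T -> i \in S /\ i != b.
  by move/(fintype.subsetP TS); rewrite !inE => /andP[].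
have bT : b \notin T by apply/negP=> /subT[_]; rewrite eqxx.
have cT : c \notin T by apply: contra cS => /subT[].
have aT : a \in T.
  have := IT.1 _ (Igen _ (mem_head _ _)).
  by rewrite meetsD !meets1 (negPf bT) orbF.
exists (var_ideal T); split; first exact: minI.
right; split; first by move/var_idealXi; apply/negP.
rewrite var_idealU1; congr var_ideal; apply/esym/Smin; last first.
  by rewrite -(finset.setD1K bS); apply: finset.setUS.
(* [b |-> - c] makes [a + b + c] vanish although [c] is kept. *)
pose e i : K := if i == b then -1 else (i \notin T)%:R.
pose s i := if i == b then c else i.
have eT i : i \in T -> e i = 0.
  by move=> iT; rewrite /e iT; case: eqP (subT i iT) => // _ [].
apply: (covI1 _ e s) => [i|i|||i|].
- by rewrite /s; case: eqVneq => [->|].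
- by rewrite !inE negb_or /s /e => /andP[/negPf-> ->].
- by rewrite substM substXi eT // scale0r mul0r.
- by rewrite substM substXi eT // scale0r mul0r.
- have /meetsP[j jT Mj] := IT.1 _ (IM i).
  by rewrite substX (bigD1 j) //= eT // expr0n (negPf Mj) mul0r scale0r.
rewrite /l !substD !substXi eT // /e /s eqxx [c == b]eq_sym (negPf bc) cT.
by rewrite scale0r add0r scaleN1r scale1r addNr.
Qed.
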